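(* Let $H\subseteq\mathbb{R}^d$ be closed and convex with $0\in\partial H$. Whenever both $H$ and its complement $\complement H=\mathbb{R}^d\setminus H$ are $+$-closed, there exists a $y_H\in\mathbb{R}^d$ such that $$H=\left\{x\in\mathbb{R}^d:\ {}^tx\,y_H\ge0\right\}.$$
   Context: A set $A\subseteq\mathbb{R}^d$ is called $+$-closed if it is measurable and $A+A\subseteq A$ (sums of elements of $A$ are again elements of $A$). ${}^tx\,y$ denotes the Euclidean inner product. *)

(* Defs.v *)
From HB Require Import structures.
From mathcomp Require Import all_boot all_order all_algebra.
From mathcomp Require Import all_classical all_reals all_analysis.

Set Implicit Arguments.
Unset Strict Implicit.
Unset Printing Implicit Defensive.

Import Order.TTheory GRing.Theory Num.Theory.
Import numFieldNormedType.Exports.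

Local Open Scope classical_set_scope.
Local Open Scope ring_scope.

Definition boundary (T : topologicalType) (A : set T) : set T :=
  closure A `\` A°.

(* The library puts no sigma-algebra on ['cV[R]_d], so measurable subsets of
   R^d are the Borel sets, given by the sigma-algebra generated by the open
   sets. *)
Definition borel (R : realType) (d : nat) (A : set 'cV[R]_d) : Prop :=
  <<s [set U : set 'cV[R]_d | open U] >> A.

Definition plus_closed (R : realType) (d : nat) (A : set 'cV[R]_d) : Prop :=
  borel A /\ [set x + y | x in A & y in A] `<=` A.

Definition inner (R : realType) (d : nat) (x y : 'cV[R]_d) : R :=
  (x^T *m y) 0 0.

(* Main.v *)
Require Import Defs.
From HB Require Import structures.
From mathcomp Require Import all_boot all_order all_algebra.
From mathcomp Require Import all_classical all_reals all_analysis.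

Import Order.TTheory GRing.Theory Num.Theory.
Import numFieldNormedType.Exports.

Local Open Scope classical_set_scope.
Local Open Scope ring_scope.

(** Closedness under addition together with convexity makes [H] a cone, and
its complement [C] is then stable under positive scaling too.  As [C] is open
and nonempty ([0] is not interior to [H]), fix [e] in [C].  Every line
[x + R e] meets both sets: [e] is interior to [C], so the line is in [C] far
enough in the direction [e]; and [- C] lies in [H], because [x] and [- x]
cannot both belong to [C] when [0 = x - x] is in [H], so the line is in [H] far
enough in the direction [- e].  Since [- e] is in [H], the trace of [H] on the
line is a downward closed ray, and it contains its end point [f x] as [H] is
closed ([closed_cone_threshold]).

So [x + t e] is in [H] exactly when [t <= f x], and [t = 0] gives
[H = {f >= 0}].  Now [H + H] inside [H] says that [f] is superadditive,
[C + C] inside [C] that it is subadditive, and stability under scaling makes it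
homogeneous.  Hence [f] is linear ([closed_halfspace]), and in coordinates it is
the inner product with a fixed vector ([linear_inner]). *)

(** A large multiple [n x] is in [H] by additivity; [a x] lies on the segment
from [0] to [n x] as soon as [a <= n]. *)
Lemma convex_add_closed_scale (R : realType) (V : lmodType R) (H : set V)
  (H0 : H 0) (convexH : convex_set H)
  (addH : forall x y, H x -> H y -> H (x + y)) (a : R) (x : V) :
  0 <= a -> H x -> H (a *: x).
Proof.
move=> a0 Hx.
have Hn n : H (x *+ n).
  by elim: n => [|n IHn]; rewrite ?mulr0n// mulrS; exact: addH.
pose n := Num.bound a.
have an : a < n%:R by exact: archi_boundP.
have n0 : 0 < n%:R :> R by exact: le_lt_trans an.
have an0 : 0 <= a / n%:R by rewrite divr_ge0 // ltW.
have an1 : a / n%:R <= 1 by rewrite ler_pdivrMr// mul1r ltW.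
have := convexH (x *+ n) 0 (Itv01 an0 an1).
rewrite !inE => /(_ (Hn n) H0).
rewrite [conv _ _ _](_ : _ = a *: x) //.
transitivity ((a / n%:R) *: (x *+ n) + (1 - a / n%:R) *: 0) => //.
by rewrite scaler0 addr0 -[x *+ n]scaler_nat scalerA divfK// gt_eqF.
Qed.

(** The complement being open makes every line parallel to [e] leave [H], and
[- e] in [H] makes the trace of [H] on it downward closed; the threshold [f x]
is the supremum of that trace. *)
Lemma closed_cone_threshold (R : realType) (V : normedModType R) (H : set V)
  (e : V) (closedH : closed H) (H0 : H 0)
  (addH : forall x y, H x -> H y -> H (x + y))
  (scaleH : forall (a : R) x, 0 <= a -> H x -> H (a *: x))
  (addCH : forall x y, ~ H x -> ~ H y -> ~ H (x + y)) (He : ~ H e) :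
  exists f : V -> R, forall x t, H (x + t *: e) <-> t <= f x.
Proof.
have oppCH x : ~ H x -> H (- x).
  by move=> Hx; apply: contrapT => /(addCH _ _ Hx); rewrite subrr.
have HNe : H (- e) by exact: oppCH.
have exit x : exists2 t : R, 0 < t & ~ H (x + t *: e).
  (* [x + t e = t (e + x / t)], and [e + s x] is outside [H] for [s] small. *)
  have cvge : e + s *: x @[s --> (0 : R)] --> e.
    rewrite -[X in _ --> X]addr0 -(scale0r x).
    by apply: cvgD; [exact: cvg_cst | apply: cvgZr_tmp; exact: cvg_id].
  have /cvge : nbhs e (~` H).
    by apply: open_nbhs_nbhs; split=> //; exact: closed_openC.
  move=> /nbhs_ballP[s /= s0 sH].
  have s20 : 0 < s / 2 by rewrite divr_gt0.
  have Hs : ~ H (e + (s / 2) *: x).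
    apply: (sH (s / 2)); rewrite /ball /= sub0r normrN gtr0_norm//.
    by rewrite ltr_pdivrMr// ltr_pMr// ltr1n.
  exists (s / 2)^-1; first by rewrite invr_gt0.
  move=> /(scaleH _ _ (ltW s20)).
  by rewrite scalerDr scalerA divff ?gt_eqF// scale1r addrC.
have down x t u : u <= t -> H (x + t *: e) -> H (x + u *: e).
  move=> ut Ht; have : H ((t - u) *: - e) by apply: scaleH; rewrite ?subr_ge0.
  by move=> /(addH _ _ Ht); rewrite scalerN scalerBl opprB -addrA subrKC.
pose S x := [set t : R | H (x + t *: e)].
have S0 x : S x !=set0.
  have [t _ /oppCH Ht] := exit (- x); exists (- t).
  by rewrite /S /= scaleNr; rewrite opprD opprK in Ht.
have ubS x : has_ubound (S x).
  have [t _ Ht] := exit x; exists t => u Su; rewrite leNgt; apply/negP => tu.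
  by apply: Ht; apply: down Su; exact: ltW.
have closedS x : closed (S x).
  have /continuous_closedP : continuous (fun t : R => x + t *: e); last exact.
  by move=> t; apply: cvgD; [exact: cvg_cst | apply: cvgZr_tmp; exact: cvg_id].
exists (fun x => sup (S x)) => x t; split=> [St|].
  exact: ub_le_sup.
move=> /down; apply; rewrite -/(S x (sup (S x))).
by apply: (closedS x); exact: closure_sup.
Qed.

(** The threshold function in a direction outside [H] is the required linear
form: each of the two additive closures gives one inequality in
[f (x + y) = f x + f y]. *)
Lemma closed_halfspace (R : realType) (V : normedModType R) (H : set V)
  (closedH : closed H) (H0 : H 0) (HT : ~` H !=set0)
  (addH : forall x y, H x -> H y -> H (x + y))
  (scaleH : forall (a : R) x, 0 <= a -> H x -> H (a *: x))
  (addCH : forall x y, ~ H x -> ~ H y -> ~ H (x + y)) :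
  exists f : {linear V -> R^o}, H = [set x | 0 <= f x].
Proof.
have [e He] := HT.
have [f fP] := @closed_cone_threshold _ _ _ e closedH H0 addH scaleH addCH He.
have fPn x t : f x < t -> ~ H (x + t *: e).
  by rewrite ltNge => /negP ft /fP.
have fD x y : f (x + y) = f x + f y.
  apply/eqP; rewrite eq_le; apply/andP; split.
    (* [x] and [y] shifted beyond their thresholds are outside [H], and so is
       their sum; the shift has to be strict, hence the slack [eps]. *)
    apply/ler_addgt0Pr => eps eps0; rewrite leNgt; apply/negP => ltf.
    have e20 : 0 < eps / 2 by rewrite divr_gt0.
    have := addCH _ _ (fPn x (f x + eps / 2) _) (fPn y (f y + eps / 2) _).
    rewrite !ltrDl e20 addrACA -scalerDl => /(_ isT isT); apply; apply/fP.
    by rewrite addrACA -splitr ltW.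
  by apply/fP; rewrite scalerDl addrACA; apply: addH; apply/fP.
have f0 : f 0 = 0 by apply: (addrI (f 0)); rewrite -fD !addr0.
have fN x : f (- x) = - f x by apply/eqP; rewrite -addr_eq0 -fD addNr f0.
(* This inequality for [a] and [a^-1] gives equality for [a > 0]. *)
have fZle a x : 0 < a -> a * f x <= f (a *: x).
  move=> a0; apply/fP; rewrite -scalerA -scalerDr.
  by apply: scaleH; [exact: ltW | exact/fP].
have fZpos a x : 0 < a -> f (a *: x) = a * f x.
  move=> a0; apply/eqP; rewrite eq_le fZle// andbT -ler_pdivrMl//.
  have := fZle a^-1 (a *: x); rewrite invr_gt0 scalerA mulVf ?gt_eqF// scale1r.
  exact.
have flin : linear (f : V -> R^o).
  move=> a x y; rewrite fD; congr (_ + _).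
  have [a0|a0|->] := ltgtP a 0.
  - rewrite -[a]opprK scaleNr fN fZpos ?oppr_gt0// scaleNr.
    by rewrite /GRing.scale.
  - by rewrite fZpos.
  - by rewrite !scale0r f0.
pose F : {linear V -> R^o} :=
  HB.pack (f : V -> R^o) (GRing.isLinear.Build R V R^o *:%R f flin).
exists F; apply/seteqP; split=> x /=.
  by move=> Hx; apply/fP; rewrite scale0r addr0.
by move=> /fP; rewrite scale0r addr0.
Qed.

Lemma linear_inner (R : realType) (d : nat) (f : {linear 'cV[R]_d -> R^o}) :
  exists y : 'cV[R]_d, forall x, f x = inner x y.
Proof.
exists (\col_i f (delta_mx i 0)) => x.
rewrite {1}(matrix_sum_delta x) linear_sum /inner mxE; apply: eq_bigr => i _.
by rewrite big_ord1 linearZ !mxE.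
Qed.

Theorem lemma3p2 (R : realType) (d : nat) (H : set 'cV[R]_d)
  (closedH : closed H) (convexH : convex_set H) (H0 : boundary H 0)
  (plusH : plus_closed H) (plusCH : plus_closed (~` H)) :
  exists yH : 'cV[R]_d, H = [set x : 'cV[R]_d | 0 <= inner x yH].
Proof.
have [cl0 int0] := H0.
have H_0 : H 0 by exact: closedH.
have addH x y : H x -> H y -> H (x + y).
  by move=> Hx Hy; apply: plusH.2; exists x => //; exists y.
have addCH x y : ~ H x -> ~ H y -> ~ H (x + y).
  by move=> Hx Hy; apply: plusCH.2; exists x => //; exists y.
have HT : ~` H !=set0.
  apply/set0P/eqP => CH0; apply: int0.
  by rewrite -[H]setCK CH0 setC0 interiorT.
have [f ->] := @closed_halfspace _ _ _ closedH H_0 HT addH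
  (@convex_add_closed_scale _ _ _ H_0 convexH addH) addCH.
have [y fy] := @linear_inner _ _ f.
by exists y; apply/seteqP; split=> x /=; rewrite fy.
Qed.
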